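(* Let $d\ge1$ and $n\ge1$ be integers, let $R>0$, and let $X$ be a random vector in $\mathbb{R}^d$ with $\|X\|\le R$ almost surely. Let $X_1,\dots,X_n$ be independent random vectors with the same law as $X$. Let $\{x_k\}_{1\le k\le n}$ be nonnegative weights, put $\Sigma=\sum_{k=1}^n e^{-x_k}$, and let $\mathrm{pen}:\{1,\dots,n\}\to\mathbb{R}_+$ be a function such that for all $1\le k\le n$, $$\mathrm{pen}(k)\ge R\left(48\sqrt{\frac{kd}{n}}+2\sqrt{\frac{x_k}{2n}}\right).$$ For each $1\le k\le n$ let $\hat c_k$ be a minimizer of $W_n$ over $S_k$, let $\hat k$ be a minimizer over $1\le k\le n$ of the penalized criterion $\mathrm{crit}(k)=W_n(\hat c_k)+\mathrm{pen}(k)$, and let $\tilde c=\hat c_{\hat k}$. Then $$\mathbb{E}\left[W(\tilde c)\right]\le\inf_{1\le k\le n}\left\{\inf_{c\in S_k}W(c)+\mathrm{pen}(k)\right\}+\Sigma R\sqrt{\frac{\pi}{2n}}.$$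
   Context: $\|\cdot\|$ is the Euclidean norm on $\mathbb{R}^d$ and $\overline{\mathcal{B}}(0,R)$ is the closed ball centered at $0$ with radius $R$. Here $\mathbb{Q}$ does not denote the rational numbers: it denotes a fixed nonempty countable set of points (''grid'', the search space for the centers) contained in $\overline{\mathcal{B}}(0,R)\subset\mathbb{R}^d$. For $k\ge1$, $S_k$ is the countable set of all codebooks $c=\{c_1,\dots,c_k\}\in\mathbb{Q}^k$, i.e. $k$-tuples of points of $\mathbb{Q}$ (repetitions allowed). For a codebook $c=\{c_1,\dots,c_k\}$, the $L^1$-distortion is the deterministic function $$W(c)=\mathbb{E}\left[\min_{j=1,\dots,k}\|X-c_j\|\right],$$ and the empirical $L^1$-distortion is $$W_n(c)=\frac1n\sum_{i=1}^n\min_{j=1,\dots,k}\|X_i-c_j\|.$$ An empirically optimal codebook $\hat c_k\in S_k$ satisfies $W_n(\hat c_k)=\min_{c\in S_k}W_n(c)$; such minimizers are taken to exist, and $\hat c_k$ and $\hat k$ are chosen as measurable functions of the sample $(X_1,\dots,X_n)$. $W(\tilde c)$ denotes the function $W$ evaluated at the random codebook $\tilde c$, so $\mathbb{E}[W(\tilde c)]$ is an expectation over the sample. *)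

(* Defs.v *)
From HB Require Import structures.
From mathcomp Require Export all_boot all_order all_algebra.
From mathcomp Require Export all_classical all_reals all_analysis.

Set Implicit Arguments.
Unset Strict Implicit.
Unset Printing Implicit Defensive.

Import Order.TTheory GRing.Theory Num.Theory.
Import numFieldNormedType.Exports.

Local Open Scope classical_set_scope.
Local Open Scope ring_scope.

(* R^d is represented by d.-tuple R because tuples, unlike 'rV[R]_d, carry a
   measurableType structure: the product sigma-algebra, that is, the Borel
   sigma-algebra of R^d. *)
Notation Rvec R d := (d.-tuple (measurableTypeR R)).

Definition vsub (R : realType) (d : nat) (x y : Rvec R d) : Rvec R d :=
  [tuple tnth x i - tnth y i | i < d].

Definition enorm (R : realType) (d : nat) (x : Rvec R d) : R :=
  Num.sqrt (\sum_(i < d) tnth x i ^+ 2).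

(* A codebook is a k-tuple of points of Q, repetitions allowed. *)
Definition codebooks (R : realType) (d : nat) (Q : set (Rvec R d)) (k : nat) :
    set (k.-tuple (Rvec R d)) :=
  [set c | forall j, Q (tnth c j)].
Arguments codebooks {R d} Q k.

(* For k >= 1 this infimum is over a finite nonempty set, hence a minimum;
   for k = 0 it is the conventional value 0. *)
Definition min_dist (R : realType) (d k : nat) (x : Rvec R d)
    (c : k.-tuple (Rvec R d)) : R :=
  inf (range (fun j : 'I_k => enorm (vsub x (tnth c j)))).

Definition distortion (disp : measure_display) (T : measurableType disp)
    (R : realType) (P : probability T R) (d : nat) (X : T -> Rvec R d)
    (k : nat) (c : k.-tuple (Rvec R d)) : \bar R :=
  'E_P[fun w => min_dist (X w) c].

Definition emp_distortion (R : realType) (d n : nat)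
    (s : n.-tuple (Rvec R d)) (k : nat) (c : k.-tuple (Rvec R d)) : R :=
  n%:R^-1 * \sum_(i < n) min_dist (tnth s i) c.

(* Product rule over all measurable A_i; finite subfamilies are covered by
   taking A_i = setT outside of the subfamily. *)
Definition mutually_independent (disp disp' : measure_display)
    (T : measurableType disp) (E : measurableType disp') (R : realType)
    (P : probability T R) (I : finType) (X : I -> T -> E) : Prop :=
  forall A : I -> set E, (forall i, measurable (A i)) ->
    P [set w | forall i, A i (X i w)] = (\prod_(i : I) P (X i @^-1` A i))%E.

Definition same_law (disp disp' : measure_display)
    (T : measurableType disp) (E : measurableType disp') (R : realType)
    (P : probability T R) (X Y : {RV P >-> E}) : Prop :=
  forall A : set E, measurable A -> distribution P X A = distribution P Y A.

Definition sample (T : Type) (E : Type) (n : nat) (X : 'I_n -> T -> E) (w : T) :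
    n.-tuple E :=
  [tuple X i w | i < n].

Definition is_minimizer (R : realType) (U : Type) (D : set U) (f : U -> R)
    (u : U) : Prop :=
  D u /\ forall v, D v -> f u <= f v.

(* crit(k) = W_n(chat_k) + pen(k), the selector chat_k being evaluated at the
   same sample s as W_n. *)
Definition crit (R : realType) (d n : nat)
    (chat : forall k : nat, n.-tuple (Rvec R d) -> k.-tuple (Rvec R d))
    (pen : nat -> R) (s : n.-tuple (Rvec R d)) (k : nat) : R :=
  emp_distortion s (chat k s) + pen k.

(* Main.v *)
Require Import Defs.
From mathcomp Require Import ring lra measurable_realfun.

Import Order.TTheory GRing.Theory Num.Theory.
Import numFieldNormedType.Exports HBNNSimple.
Local Open Scope classical_set_scope.
Local Open Scope ring_scope.

(** Write Delta_k for the supremum of W - W_n over the codebooks of size k.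
By minimality of the selectors, for every k and every c in S_k,
  W(c~) <= W_n(c) + pen(k) + (Delta_khat - pen(khat)),
and the mean of W_n(c) is W(c). It therefore suffices that, for each k, the
positive part of Delta_k - pen(k) has mean at most
exp(- x_k) rad sqrt(pi / (2 n)); these bounds are summed over all possible
values of khat.

Two facts give this bound. First, replacing one observation moves Delta_k by
at most 2 rad / n, since distances inside the ball lie in [0, 2 rad]; hence
the moment generating function of Delta_k around its mean is at most that of a
Gaussian of variance rad^2 / n ([hoeffding_lemma], [mcdiarmid_mgf]). The
constant is sharp, which the term 2 rad sqrt(x_k / (2 n)) of the penalty
requires. The inequality max(0, z) <= exp(t z) / t with the optimal t then
bounds the excess ([iid_mean_excess_gauss]). Second, the mean of Delta_k is at
most 9 rad sqrt(k d / n) ([expected_max_deviation_le]). This is a chaining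
argument: at scale rad / 2^j there are at most e^(k d (j + 3)) codebooks, the
distance to a codebook is 1-Lipschitz in the largest displacement of a center,
so the links of level j are sub-Gaussian with deviation rad / (2^j sqrt n), and
the sum over j of 2^-j (j + 7/2) is at most 9. The factor 48 in the penalty
leaves plenty of room.

All of this takes place in a finite probability space. Observations and
centers are rounded towards zero, coordinate by coordinate, to a grid of mesh
rad / (2^n sqrt d). Rounding does not leave the ball and moves a point by at
most rad / 2^n, so W - W_n changes by at most 4 rad / 2^n, far less than the
room left by the penalty. After rounding the supremum is over finitely many
codebooks, the sample has finitely many values, and independence says that
their probabilities are products ([grid_sample_mean]); expectations become the
recursive weighted sums [iid_mean], for which concentration is an induction
over the sample size. The dyadic grids are nested, because q %/ 2^i determines
q %/ 2^(i+1), so a link of the chain is determined by its finer endpoint. *)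

Set Implicit Arguments.
Unset Strict Implicit.
Unset Printing Implicit Defensive.

(** * Hoeffding's lemma for two-point laws *)

Lemma eq_ler (R : numDomainType) (x y : R) : x = y -> x <= y.
Proof. by move=> ->. Qed.

Lemma ge0_of_derive_ge0 (R : realType) (f f' : R -> R) :
  (forall x : R, is_derive x (1 : R) f (f' x)) ->
  (forall x : R, 0 <= x -> 0 <= f' x) ->
  0 <= f 0 -> forall x : R, 0 <= x -> 0 <= f x.
Proof.
move=> df f'0 f0 x x0; apply: (le_trans f0).
apply: (@ger0_derive1_ndecry R f 0) => //.
- move=> y; rewrite in_itv /= andbT => y0.
  by have d := df y; rewrite derive1E derive_val; apply/f'0/ltW.
- apply: derivable_within_continuous => y _.
  by have d := df y; apply: ex_derive.
Qed.

(** The logarithm of the right-hand side over the left-hand side vanishes at 0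
together with its derivative, and its second derivative is 1/4 - v (1 - v) for
some v, hence nonnegative. *)
Lemma bernoulli_mgf_le (R : realType) (q u : R) : 0 <= q <= 1 -> 0 <= u ->
  1 - q + q * expR u <= expR (q * u + u ^+ 2 / 8).
Proof.
move=> /andP[q0 q1] u0.
pose D (x : R) : R := 1 - q + q * expR x.
have D0 x : 0 < D x.
  rewrite /D; have e0 := expR_gt0 x.
  have [->|qn0] := eqVneq q 0; first by lra.
  have : 0 < q * expR x by apply: mulr_gt0 => //; rewrite lt0r qn0.
  lra.
have dD (x : R) : is_derive x (1 : R) D (q * expR x).
  by apply: is_derive_eq; rewrite /GRing.scale /=; ring.
have dDV (x : R) : is_derive x (1:R) (fun x => (D x)^-1) (- (D x)^-2 * (q * expR x)).
  by apply: is_deriveV; rewrite gt_eqF.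
(* psi is the logarithm of the ratio of the two sides *)
pose psi (x : R) : R := q * x + x ^+ 2 / 8 - ln (D x).
pose psi' (x : R) : R := q + x / 4 - q * expR x * (D x)^-1.
have dpsi (x : R) : is_derive x (1 : R) psi (psi' x).
  have dl : is_derive x (1 : R) (@ln R \o D) ((D x)^-1 * (q * expR x)).
    exact: is_derive1_comp (is_derive1_ln (D0 x)) _.
  rewrite /psi; apply: is_derive_eq; rewrite /psi' /GRing.scale /=; field.
  by rewrite gt_eqF.
have dpsi' (x : R) : is_derive x (1:R) psi' (4^-1 - q * (1 - q) * expR x / (D x) ^+ 2).
  rewrite /psi'; apply: is_derive_eq; rewrite /GRing.scale /=.
  have -> : q * (1 - q) * expR x = (D x - q * expR x) * (q * expR x).
    by rewrite /D; ring.
  by field; rewrite gt_eqF.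
have psi'_ge0 (x : R) : 0 <= x -> 0 <= psi' x.
  apply: (ge0_of_derive_ge0 dpsi') => [y _|].
    rewrite subr_ge0 ler_pdivrMr ?exprn_gt0 //.
    rewrite -subr_ge0; have -> : 4^-1 * D y ^+ 2 - q * (1 - q) * expR y
      = (1 - q - q * expR y) ^+ 2 / 4 by rewrite /D; field.
    by rewrite divr_ge0 ?sqr_ge0.
  by rewrite /psi' /D expR0 mulr1 subrK invr1 mulr1 mul0r addr0 subrr.
have : 0 <= psi u.
  apply: (ge0_of_derive_ge0 dpsi psi'_ge0) => //.
  by rewrite /psi /D expR0 mulr1 subrK ln1 mulr0 expr0n mul0r addr0 subr0.
by rewrite /psi subr_ge0 -ler_expR lnK ?posrE.
Qed.

(** * Finite probability spaces: concentration and maximal inequalities *)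

(** The tangent of exp at th v lies below exp at both 0 and v; average the two
bounds with weights 1 - th and th. *)
Lemma expR_chord_le (R : realType) (th v : R) : 0 <= th <= 1 ->
  expR (th * v) <= 1 - th + th * expR v.
Proof.
move=> /andP[th0 th1].
have tangent y : expR (th * v) * (1 + (y - th * v)) <= expR y.
  rewrite -[X in _ <= expR X](subrKC (th * v)) expRD.
  by rewrite ler_wpM2l ?expR_ge0 // expR_ge1Dx.
have := ler_wpM2l th0 (tangent v).
have : (1 - th) * (expR (th * v) * (1 + (0 - th * v))) <= (1 - th) * 1.
  by apply: ler_wpM2l; [lra|rewrite -[X in _ <= X]expR0; exact: tangent].
lra.
Qed.

Section FiniteProbability.
Variables (R : realType) (B : finType) (p : B -> R).
Hypotheses (p_ge0 : forall b, 0 <= p b) (p_sum1 : \sum_b p b = 1).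

Definition mean (h : B -> R) : R := \sum_b p b * h b.

(** Expectation of a function of n independent draws from p. The recursion on the
first draw is the conditioning used in every induction over the sample size;
samples are lists so that the inductions do not change types. *)
Fixpoint iid_mean (n : nat) (f : seq B -> R) : R :=
  if n is n'.+1 then mean (fun b => iid_mean n' (fun s => f (b :: s)))
  else f [::].

Lemma mean_cst c : mean (fun=> c) = c.
Proof. by rewrite /mean -big_distrl /= p_sum1 mul1r. Qed.

Lemma ler_mean f g : (forall b, f b <= g b) -> mean f <= mean g.
Proof. by move=> fg; apply: ler_sum => b _; rewrite ler_wpM2l. Qed.

Lemma eq_mean f g : (forall b, f b = g b) -> mean f = mean g.
Proof. by move=> fg; apply: eq_bigr => b _; rewrite fg. Qed.

Lemma meanZ c f : mean (fun b => c * f b) = c * mean f.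
Proof. by rewrite /mean big_distrr; apply: eq_bigr => b _; rewrite mulrCA. Qed.

Lemma mean_sum (I : Type) (r : seq I) (P : pred I) (F : I -> B -> R) :
  mean (fun b => \sum_(i <- r | P i) F i b) = \sum_(i <- r | P i) mean (F i).
Proof.
rewrite /mean exchange_big; apply: eq_bigr => b _.
by rewrite big_distrr.
Qed.

Lemma meanD f g : mean (fun b => f b + g b) = mean f + mean g.
Proof. by rewrite /mean -big_split; apply: eq_bigr => b _; rewrite mulrDr. Qed.

Lemma meanB f g : mean (fun b => f b - g b) = mean f - mean g.
Proof. by rewrite /mean -sumrB; apply: eq_bigr => b _; rewrite mulrBr. Qed.

Lemma iid_mean_cst n c : iid_mean n (fun=> c) = c.
Proof. by elim: n => //= n ->; exact: mean_cst. Qed.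

Lemma ler_iid_mean n f g : (forall s, size s = n -> f s <= g s) ->
  iid_mean n f <= iid_mean n g.
Proof.
elim: n f g => /= [f g ->|n IH f g fg] //; apply: ler_mean => b.
by apply: IH => s sn; apply: fg; rewrite /= sn.
Qed.

Lemma eq_iid_mean n f g : (forall s, f s = g s) -> iid_mean n f = iid_mean n g.
Proof. by move=> fg; congr iid_mean; apply/funext. Qed.

Lemma iid_meanZ n c f : iid_mean n (fun s => c * f s) = c * iid_mean n f.
Proof.
by elim: n f => //= n IH f; rewrite -meanZ; apply: eq_mean => b; rewrite IH.
Qed.

Lemma iid_meanD n f g :
  iid_mean n (fun s => f s + g s) = iid_mean n f + iid_mean n g.
Proof.
by elim: n f g => //= n IH f g; rewrite -meanD; apply: eq_mean => b; rewrite IH.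
Qed.

Lemma iid_meanB n f g :
  iid_mean n (fun s => f s - g s) = iid_mean n f - iid_mean n g.
Proof.
by elim: n f g => //= n IH f g; rewrite -meanB; apply: eq_mean => b; rewrite IH.
Qed.

Lemma iid_mean_sum n (I : Type) (r : seq I) (P : pred I) (F : I -> seq B -> R) :
  iid_mean n (fun s => \sum_(i <- r | P i) F i s) =
  \sum_(i <- r | P i) iid_mean n (F i).
Proof.
elim: n F => //= n IH F; rewrite -mean_sum; apply: eq_mean => b.
by rewrite IH.
Qed.

(** By convexity, exp (t g) is at most its chord over an interval of length c that
contains the values of g. Averaging the chord replaces g by a two-point variable
of the same mean, which [bernoulli_mgf_le] bounds. *)
Lemma hoeffding_lemma (g : B -> R) (c t : R) : 0 <= t ->
  (forall a b, g a - g b <= c) ->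
  mean (fun b => expR (t * g b)) <= expR (t * mean g + (t * c) ^+ 2 / 8).
Proof.
move=> t0 gc.
have [b0 _|B0] := pickP (@predT B); last first.
  by move: p_sum1; rewrite big_pred0 // => /eqP; rewrite eq_sym oner_eq0.
have c0 : 0 <= c by have := gc b0 b0; rewrite subrr.
pose bm := [arg min_(b < b0) g b]%O; pose m := g bm.
have gm b : 0 <= g b - m.
  by rewrite subr_ge0 /m /bm; case: arg_minP => // i _; exact.
(* position of g b in the interval [m, m + c]; if c = 0 then g is constant and
   the convention 1 / 0 = 0 gives the right value *)
pose th b := (g b - m) / c.
have thE b : g b = m + th b * c.
  have [c00|cn0] := eqVneq c 0; last by rewrite /th divfK // subrKC.
  by have := gc b bm; have := gm b; rewrite -/m c00; lra.
have th01 b : 0 <= th b <= 1.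
  rewrite divr_ge0 //=; have [c00|cn0] := eqVneq c 0.
    by rewrite /th c00 invr0 mulr0.
  by rewrite /th ler_pdivrMr ?lt0r ?cn0 // mul1r gc.
pose q := mean th.
have q01 : 0 <= q <= 1.
  rewrite -[X in X <= q](mean_cst 0) -[X in _ && (q <= X)](mean_cst 1).
  by apply/andP; split; apply: ler_mean => b; case/andP: (th01 b).
have gE : mean g = m + q * c.
  rewrite -[m]mean_cst mulrC -meanZ -meanD; apply: eq_mean => b.
  by rewrite mulrC.
apply: (@le_trans _ _ (mean (fun b => expR (t * m) * (1 - th b + th b * expR (t * c))))).
  apply: ler_mean => b; rewrite {1}thE mulrDr expRD ler_wpM2l ?expR_ge0 //.
  by rewrite mulrCA expR_chord_le.
rewrite meanZ meanD meanB mean_cst -/q.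
rewrite (_ : mean _ = q * expR (t * c)); last first.
  by rewrite [RHS]mulrC /q -meanZ; apply: eq_mean => b; rewrite mulrC.
rewrite gE (mulrDr t) -(addrA (t * m)) expRD ler_wpM2l ?expR_ge0 //.
by rewrite mulrCA; apply: bernoulli_mgf_le => //; exact: mulr_ge0.
Qed.

Definition bounded_differences (F : seq B -> R) (c : R) :=
  forall s1 a b s2, F (s1 ++ a :: s2) - F (s1 ++ b :: s2) <= c.

(** Condition on the first draw: the conditional mean as a function of that draw
again varies by at most c, so Hoeffding's lemma contributes one factor and the
induction hypothesis the remaining ones. *)
Lemma mcdiarmid_mgf n (F : seq B -> R) (c t : R) : 0 <= t ->
  bounded_differences F c ->
  iid_mean n (fun s => expR (t * F s)) <=
  expR (t * iid_mean n F + n%:R * ((t * c) ^+ 2 / 8)).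
Proof.
move=> t0; elim: n F => [|n IH] F Fc /=; first by rewrite mul0r addr0.
have Fbc b : bounded_differences (fun s => F (b :: s)) c.
  by move=> s1 a a' s2; apply: (Fc (b :: s1)).
apply: (le_trans (ler_mean (fun b => IH _ (Fbc b)))).
set r := n%:R * _.
rewrite (@eq_mean _ (fun b => expR r * expR (t * iid_mean n (fun s => F (b :: s))))); last first.
  by move=> b; rewrite -expRD addrC.
rewrite meanZ -natr1 mulrDl mul1r (addrC (n%:R * _)) addrA -/r.
rewrite (addrC _ r) (expRD r) ler_wpM2l ?expR_ge0 //.
apply: hoeffding_lemma => // a b; rewrite -iid_meanB -[c](iid_mean_cst n).
by apply: ler_iid_mean => s _; apply: (Fc [::]).
Qed.


(** The normalization is a parameter instead of the length of the list, so that
the bounded differences hold for lists of every length. *)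
Definition dev (n : nat) (h : B -> R) (s : seq B) : R :=
  n%:R^-1 * \sum_(b <- s) (mean h - h b).

Lemma devB n h h' s : dev n (fun b => h b - h' b) s = dev n h s - dev n h' s.
Proof.
rewrite /dev -mulrBr -sumrB; congr (_ * _); apply: eq_bigr => b _.
by rewrite meanB; ring.
Qed.

Lemma iid_mean_dev n h : iid_mean n (dev n h) = 0.
Proof.
rewrite iid_meanZ -[RHS](mulr0 n%:R^-1); congr (_ * _).
elim: n => [|n IH] /=; first by rewrite big_nil.
under [X in mean X]funext => b.
  rewrite (@eq_iid_mean _ _
    (fun s => (mean h - h b) + \sum_(b' <- s) (mean h - h b'))); last first.
    by move=> s; rewrite big_cons.
  rewrite iid_meanD iid_mean_cst // IH addr0.
  over.
by rewrite meanB mean_cst // subrr.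
Qed.

Lemma dev_bounded_differences n h c : (forall a b, h a - h b <= c) ->
  bounded_differences (dev n h) (c / n%:R).
Proof.
move=> hc s1 a b s2; rewrite /dev -mulrBr mulrC ler_wpM2r ?invr_ge0 //.
rewrite !big_cat !big_cons /=; have := hc b a; lra.
Qed.

Lemma dev_mgf_le n h c t : (0 < n)%N -> 0 <= t -> (forall a b, h a - h b <= c) ->
  iid_mean n (fun s => expR (t * dev n h s)) <=
  expR (t ^+ 2 * c ^+ 2 / (8 * n%:R)).
Proof.
move=> n0 t0 hc.
apply: le_trans (mcdiarmid_mgf n t0 (dev_bounded_differences n hc)) _.
rewrite iid_mean_dev mulr0 add0r; apply: eq_ler.
by congr expR; field; rewrite pnatr_eq0 -lt0n.
Qed.

(** The index u may depend on the sample, so this bounds the mean of a maximum over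
U. By Jensen exp of t times the mean is at most the mean of the exponential,
which is at most the sum over U of the generating functions. *)
Lemma iid_mean_max_dev_le n (I : finType) (U : {set I}) (h : I -> B -> R)
    (u : seq B -> I) (c L t : R) : (0 < n)%N -> 0 < t ->
  (forall s, u s \in U) -> #|U|%:R <= expR L ->
  (forall i, i \in U -> forall a b, h i a - h i b <= c) ->
  iid_mean n (fun s => dev n (h (u s)) s) <= L / t + t * c ^+ 2 / (8 * n%:R).
Proof.
move=> n0 t0 uU UL hc; set G := fun s => dev n (h (u s)) s.
set m := iid_mean n G; set r := t ^+ 2 * c ^+ 2 / (8 * n%:R).
suff : t * m <= L + r.
  rewrite mulrC -ler_pdivlMr // => /le_trans; apply.
  rewrite mulrDl lerD2l /r; apply: eq_ler.
  by field; rewrite pnatr_eq0 -lt0n n0 gt_eqF.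
rewrite -ler_expR expRD.
apply: (@le_trans _ _ (iid_mean n (fun s => expR (t * G s)))).
  (* Jensen: average the tangent of exp at t m *)
  have -> : expR (t * m) =
      iid_mean n (fun s => expR (t * m) * (1 + (t * G s - t * m))).
    rewrite iid_meanZ iid_meanD iid_mean_cst // iid_meanB iid_mean_cst //.
    by rewrite iid_meanZ subrr addr0 mulr1.
  apply: ler_iid_mean => // s _.
  rewrite -[X in _ <= expR X](subrKC (t * m)) expRD.
  by rewrite ler_wpM2l ?expR_ge0 // expR_ge1Dx.
apply: (@le_trans _ _ (\sum_(i in U) iid_mean n (fun s => expR (t * dev n (h i) s)))).
  rewrite -iid_mean_sum; apply: ler_iid_mean => // s _.
  rewrite (bigD1 (u s)) //= lerDl; apply: sumr_ge0 => i _; exact: expR_ge0.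
apply: (@le_trans _ _ (\sum_(i in U) expR r)).
  by apply: ler_sum => i iU; apply: dev_mgf_le => //; [exact: ltW|exact: hc].
by rewrite sumr_const -mulr_natl ler_wpM2r ?expR_ge0.
Qed.

(** The bound max(0, z) <= exp(t z) / t turns the excess into a generating
function. *)
Lemma iid_mean_excess_le n (F : seq B -> R) (c M t : R) : (0 < n)%N -> 0 < t ->
  bounded_differences F (c / n%:R) ->
  iid_mean n (fun s => Num.max 0 (F s - M)) <=
  expR (t * (iid_mean n F - M) + t ^+ 2 * c ^+ 2 / (8 * n%:R)) / t.
Proof.
move=> n0 t0 Fc; rewrite ler_pdivlMr // mulrC -iid_meanZ.
apply: (@le_trans _ _ (iid_mean n (fun s => expR (- (t * M)) * expR (t * F s)))).
  apply: ler_iid_mean => // s _; rewrite -expRD.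
  rewrite (_ : - (t * M) + t * F s = t * (F s - M)); last by ring.
  have [le0|gt0] := leP (F s - M) 0; first by rewrite mulr0 expR_ge0.
  by apply: le_trans (expR_ge1Dx _); rewrite lerDr.
rewrite iid_meanZ mulrBr addrAC expRD mulrC ler_wpM2r ?expR_ge0 //.
apply: le_trans (mcdiarmid_mgf n (ltW t0) Fc) _.
rewrite ler_expR lerD2l; apply: eq_ler.
by field; rewrite pnatr_eq0 -lt0n.
Qed.

(** The Gaussian tail beyond 2 r sqrt(x / (2 n)) produces exp(- x). The extra
margin r / sqrt n below M, one standard deviation, keeps the optimal t away from
0, so that no integration of the tail is needed. *)
Lemma iid_mean_excess_gauss n (F : seq B -> R) (r x M : R) : (0 < n)%N ->
  0 < r -> 0 <= x -> bounded_differences F (2 * r / n%:R) ->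
  iid_mean n F + r / Num.sqrt n%:R + 2 * r * Num.sqrt (x / (2 * n%:R)) <= M ->
  iid_mean n (fun s => Num.max 0 (F s - M)) <= expR (- x) * (r / Num.sqrt n%:R).
Proof.
move=> n0 r0 x0 Fc FM.
set y := Num.sqrt n%:R in FM *; have y0 : 0 < y by rewrite sqrtr_gt0 ltr0n.
have y2 : n%:R = y ^+ 2 by rewrite sqr_sqrtr.
pose z := Num.sqrt (x / (2 * n%:R)).
have z0 : 0 <= z by exact: sqrtr_ge0.
have z2 : x = 2 * (z * y) ^+ 2.
  rewrite exprMn -y2 sqr_sqrtr; first by field; rewrite pnatr_eq0 -lt0n.
  by rewrite divr_ge0 // mulr_ge0.
pose v := r / y + 2 * r * z.
have v0 : 0 < v by rewrite ltr_pwDl ?divr_gt0 // mulr_ge0 // mulr_ge0 // ltW.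
(* the minimizer of - t v + t ^ 2 r ^ 2 / (2 n) *)
pose t := v * y ^+ 2 / r ^+ 2.
have t0 : 0 < t by rewrite divr_gt0 ?exprn_gt0 // mulr_gt0 ?exprn_gt0.
apply: le_trans (iid_mean_excess_le M n0 t0 Fc) _.
rewrite ler_pM ?expR_ge0 ?invr_ge0 ?(ltW t0) //.
  rewrite ler_expR.
  apply: (@le_trans _ _ (t * - v + t ^+ 2 * (2 * r) ^+ 2 / (8 * n%:R))).
    by rewrite lerD2r ler_pM2l //; move: FM; rewrite /v -/z; lra.
  rewrite (_ : _ + _ = - (v * y / r) ^+ 2 / 2); last first.
    by rewrite y2 /t; field; rewrite !gt_eqF.
  rewrite mulNr lerN2 z2 (_ : v * y / r = 1 + 2 * (z * y)); last first.
    by rewrite /v; field; rewrite !gt_eqF.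
  have zy0 : 0 <= z * y by rewrite mulr_ge0 // ltW.
  by move: zy0; move: (z * y) => w w0; nra.
rewrite -[X in _ <= X]invrK lef_pV2 ?posrE ?invr_gt0 ?divr_gt0 ?mulr_gt0 ?exprn_gt0 //.
rewrite (_ : (r / y)^-1 = (r / y) * y ^+ 2 / r ^+ 2); last first.
  by field; rewrite !gt_eqF.
rewrite /t !ler_pM2r ?invr_gt0 ?exprn_gt0 //.
by rewrite lerDl mulr_ge0 // mulr_ge0 // ltW.
Qed.

End FiniteProbability.

(** * Euclidean distance and distance to a codebook *)

Section Euclidean.
Variables (R : realType) (d : nat).
Implicit Types (a b : 'I_d -> R) (x y z : Rvec R d).

Lemma cauchy_schwarz_sum a b :
  \sum_i a i * b i <=
  Num.sqrt (\sum_i a i ^+ 2) * Num.sqrt (\sum_i b i ^+ 2).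
Proof.
set A := Num.sqrt (\sum_i a i ^+ 2); set C := Num.sqrt (\sum_i b i ^+ 2).
have sq_ge0 (f : 'I_d -> R) : 0 <= \sum_i f i ^+ 2.
  by apply: sumr_ge0 => i _; exact: sqr_ge0.
have A2 : A ^+ 2 = \sum_i a i ^+ 2 by rewrite sqr_sqrtr.
have C2 : C ^+ 2 = \sum_i b i ^+ 2 by rewrite sqr_sqrtr.
have A0 : 0 <= A := sqrtr_ge0 _; have C0 : 0 <= C := sqrtr_ge0 _.
have vanish (f g : 'I_d -> R) : \sum_i f i ^+ 2 = 0 -> \sum_i f i * g i = 0.
  move=> /eqP; rewrite psumr_eq0; last by move=> i _; exact: sqr_ge0.
  move=> /allP f0; apply: big1 => i _.
  by have := f0 i (mem_index_enum _); rewrite /= sqrf_eq0 => /eqP ->; rewrite mul0r.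
have [A00|An0] := eqVneq A 0.
  by rewrite vanish ?A00 ?mul0r // -A2 A00 expr0n.
have [C00|Cn0] := eqVneq C 0.
  rewrite C00 mulr0; under eq_bigr do rewrite mulrC.
  by rewrite vanish // -C2 C00 expr0n.
have pA : 0 < A by rewrite lt0r An0.
have pC : 0 < C by rewrite lt0r Cn0.
(* AM-GM termwise, weighted so that both sums become A C *)
apply: (@le_trans _ _ (\sum_i (C / A * a i ^+ 2 + A / C * b i ^+ 2) / 2)).
  apply: ler_sum => i _; rewrite -subr_ge0.
  rewrite (_ : _ - _ = (C * a i - A * b i) ^+ 2 / (2 * (A * C))); last first.
    by field; rewrite An0 Cn0.
  by rewrite divr_ge0 ?sqr_ge0 // mulr_ge0 // mulr_ge0.
rewrite -big_distrl big_split /= -!big_distrr /= -A2 -C2.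
by apply: eq_ler; field; rewrite An0 Cn0.
Qed.

(** Cauchy-Schwarz against the constant vector. *)
Lemma sum_abs_le_enorm x : \sum_i `|tnth x i| <= Num.sqrt d%:R * enorm x.
Proof.
have := cauchy_schwarz_sum (fun=> 1) (fun i => `|tnth x i|).
under eq_bigr do rewrite mul1r.
rewrite expr1n sumr_const card_ord /enorm => /le_trans; apply.
apply: eq_ler.
congr (_ * Num.sqrt _).
by apply: eq_bigr => i _; rewrite real_normK ?num_real.
Qed.

Lemma enorm_ge0 x : 0 <= enorm x. Proof. exact: sqrtr_ge0. Qed.

Lemma ler_enorm x y : (forall i, `|tnth x i| <= `|tnth y i|) ->
  enorm x <= enorm y.
Proof.
move=> xy; rewrite ler_sqrt; last by apply: sumr_ge0 => i _; exact: sqr_ge0.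
apply: ler_sum => i _; rewrite -(real_normK (num_real (tnth x i))).
by rewrite -(real_normK (num_real (tnth y i))) lerXn2r ?nnegrE.
Qed.

Lemma enorm_le_coord x (M : R) : 0 <= M -> (forall i, `|tnth x i| <= M) ->
  enorm x <= Num.sqrt d%:R * M.
Proof.
move=> M0 xM; rewrite -[X in _ * X](ger0_norm M0) -sqrtr_sqr -sqrtrM ?ler0n //.
rewrite ler_sqrt; last by rewrite mulr_ge0 ?sqr_ge0.
apply: (@le_trans _ _ (\sum_(i < d) M ^+ 2)).
  apply: ler_sum => i _; rewrite -(real_normK (num_real (tnth x i))).
  by rewrite lerXn2r ?nnegrE.
by rewrite sumr_const card_ord mulr_natl.
Qed.

Lemma coord_le_enorm x i : `|tnth x i| <= enorm x.
Proof.
rewrite -sqrtr_sqr ler_sqrt; last by apply: sumr_ge0 => j _; exact: sqr_ge0.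
by rewrite (bigD1 i) //= lerDl; apply: sumr_ge0 => j _; exact: sqr_ge0.
Qed.

Lemma tnth_vsub x y i : tnth (vsub x y) i = tnth x i - tnth y i.
Proof. by rewrite tnth_mktuple. Qed.

Lemma enorm_vsubC x y : enorm (vsub x y) = enorm (vsub y x).
Proof.
congr Num.sqrt; apply: eq_bigr => i _.
by rewrite !tnth_vsub -sqrrN opprB.
Qed.

Lemma enorm_add_le x y z : (forall i, tnth z i = tnth x i + tnth y i) ->
  enorm z <= enorm x + enorm y.
Proof.
move=> zE; rewrite -(ler_pXn2r (_ : 0 < 2)%N) ?nnegrE ?addr_ge0 ?enorm_ge0 //.
have sq (w : Rvec R d) : enorm w ^+ 2 = \sum_i tnth w i ^+ 2.
  by rewrite sqr_sqrtr // sumr_ge0 // => i _; exact: sqr_ge0.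
rewrite sqrrD !sq.
have := cauchy_schwarz_sum (tnth x) (tnth y); rewrite -/(enorm x) -/(enorm y) => cs.
apply: (@le_trans _ _ (\sum_i tnth x i ^+ 2 + (\sum_i tnth x i * tnth y i) *+ 2
   + \sum_i tnth y i ^+ 2)); last by rewrite !lerD2r lerD2l lerMn2r.
rewrite -sumrMnl -!big_split /=; apply: ler_sum => i _.
by rewrite zE sqrrD.
Qed.

Lemma enorm_vsub_triangle y x z :
  enorm (vsub x z) <= enorm (vsub x y) + enorm (vsub y z).
Proof. by apply: enorm_add_le => i; rewrite !tnth_vsub; ring. Qed.

Lemma enorm_vsub_le x y : enorm (vsub x y) <= enorm x + enorm y.
Proof.
have -> : enorm y = enorm (vsub [tuple 0 | _ < d] y).
  congr Num.sqrt; apply: eq_bigr => i _.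
  by rewrite tnth_vsub tnth_mktuple sub0r sqrrN.
by apply: enorm_add_le => i; rewrite !tnth_vsub tnth_mktuple; ring.
Qed.

End Euclidean.

Section MinDist.
Variables (R : realType) (d : nat).
Implicit Types (x y : Rvec R d).

Lemma min_dist_lb k x (c : k.-tuple (Rvec R d)) j :
  min_dist x c <= enorm (vsub x (tnth c j)).
Proof.
apply: ge_inf; last by exists j.
by exists 0 => _ [i _ <-]; exact: enorm_ge0.
Qed.

Lemma le_min_dist k x (c : k.-tuple (Rvec R d)) M : (0 < k)%N ->
  (forall j, M <= enorm (vsub x (tnth c j))) -> M <= min_dist x c.
Proof.
move=> k0 cM; apply: lb_le_inf; first by eexists; exists (Ordinal k0).
by move=> _ [j _ <-].
Qed.

Lemma min_dist_ge0 k x (c : k.-tuple (Rvec R d)) : 0 <= min_dist x c.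
Proof.
case: k c => [c|k c]; last by apply: le_min_dist => // j; exact: enorm_ge0.
rewrite /min_dist (_ : [set _ | _ in _] = set0) ?inf0 //.
by rewrite -subset0 => y [] [] j.
Qed.

Lemma min_dist_lipschitz k x y (c e : k.-tuple (Rvec R d)) M : (0 < k)%N ->
  (forall j, enorm (vsub x (tnth c j)) <= enorm (vsub y (tnth e j)) + M) ->
  min_dist x c <= min_dist y e + M.
Proof.
move=> k0 H; rewrite -lerBlDr; apply: le_min_dist => // j.
by rewrite lerBlDr; apply: le_trans (H j); exact: min_dist_lb.
Qed.

Lemma min_dist_le_radius k x (c : k.-tuple (Rvec R d)) rad : (0 < k)%N ->
  enorm x <= rad -> (forall j, enorm (tnth c j) <= rad) ->
  min_dist x c <= 2 * rad.
Proof.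
move=> k0 xr cr; apply: le_trans (min_dist_lb x c (Ordinal k0)) _.
apply: le_trans (enorm_vsub_le _ _) _.
by rewrite mulr_natl mulr2n lerD.
Qed.

Lemma min_dist_close k x y (c e : k.-tuple (Rvec R d)) M N : (0 < k)%N ->
  enorm (vsub x y) <= M -> (forall j, enorm (vsub (tnth c j) (tnth e j)) <= N) ->
  `|min_dist x c - min_dist y e| <= M + N.
Proof.
move=> k0 xy ce.
have h1 : min_dist x c <= min_dist y e + (M + N).
  apply: min_dist_lipschitz => // j.
  have := enorm_vsub_triangle y x (tnth c j).
  have := enorm_vsub_triangle (tnth e j) y (tnth c j).
  by have := ce j; rewrite (enorm_vsubC (tnth c j)); move: xy; lra.
have h2 : min_dist y e <= min_dist x c + (M + N).
  apply: min_dist_lipschitz => // j.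
  have := enorm_vsub_triangle x y (tnth e j).
  have := enorm_vsub_triangle (tnth c j) x (tnth e j).
  by have := ce j; move: xy; rewrite (enorm_vsubC x); lra.
by rewrite ler_norml; apply/andP; split; lra.
Qed.

End MinDist.

(** * Dyadic grid codes and their number *)

(** The ratio exp(- 1 / M) is at most M / (M + 1). *)
Lemma geo_sum_expR_le (R : realType) (M : R) N : 0 < M ->
  \sum_(q < N) expR (- (q%:R / M)) <= M + 1.
Proof.
move=> M0; set th := expR (- M^-1).
have th0 : 0 < th := expR_gt0 _.
have thM : (M + 1) * th <= M.
  rewrite /th expRN ler_pdivrMr ?expR_gt0 //.
  apply: (@le_trans _ _ (M * (1 + M^-1))).
    by rewrite mulrDr mulr1 divff ?gt_eqF.
  by rewrite ler_pM2l // expR_ge1Dx.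
have -> : \sum_(q < N) expR (- (q%:R / M)) = \sum_(q < N) th ^+ q.
  by apply: eq_bigr => q _; rewrite /th -expRM_natl mulrN.
set S := \sum_(_ < _) _.
have S0 : 0 <= S by apply: sumr_ge0 => q _; rewrite exprn_ge0 // ltW.
have : th ^+ N - 1 = (th - 1) * S by rewrite subrX1.
have : 0 < th ^+ N by rewrite exprn_gt0.
move: (th ^+ N) => z z0 zE.
have h1 : (1 - th) * S <= 1 by lra.
have h2 : 1 <= (M + 1) * (1 - th) by lra.
have M1 : 0 <= M + 1 by lra.
have := ler_wpM2l M1 h1; have := ler_wpM2r S0 h2; lra.
Qed.

Section Codes.
Variables (R : realType) (d m : nat).

Local Notation code := {ffun 'I_d -> bool * 'I_m.+1}.

(** A code stores signs and absolute values separately, so that rounding towards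
zero is integer division of the absolute values. *)
Definition decode (r : R) (u : code) : Rvec R d :=
  [tuple (-1) ^+ (u l).1 * (u l).2%:R * r | l < d].

Definition coarsen (i : nat) (u : code) : code :=
  [ffun l => ((u l).1, inord ((u l).2 %/ 2 ^ i)%N)].

Lemma coarsenE i u l : ((coarsen i u l).2 = (u l).2 %/ 2 ^ i :> nat)%N.
Proof.
by rewrite ffunE /= inordK // (leq_ltn_trans (leq_div _ _)) ?ltn_ord.
Qed.

Lemma coarsen_sign i u l : (coarsen i u l).1 = (u l).1.
Proof. by rewrite ffunE. Qed.

Lemma coarsenS i u : coarsen i.+1 u = coarsen 1 (coarsen i u).
Proof.
apply/ffunP => l; rewrite [LHS]surjective_pairing [RHS]surjective_pairing.
rewrite !coarsen_sign; congr (_, _); apply: val_inj => /=.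
by rewrite !coarsenE -divnMA expn1 expnSr.
Qed.

Lemma coarsen0 u : coarsen 0 u = u.
Proof.
apply/ffunP => l; rewrite [LHS]surjective_pairing [RHS]surjective_pairing.
rewrite coarsen_sign; congr (_, _); apply: val_inj => /=.
by rewrite coarsenE expn0 divn1.
Qed.

Lemma abs_decode r u l : 0 <= r -> `|tnth (decode r u) l| = (u l).2%:R * r.
Proof.
by move=> r0; rewrite tnth_mktuple normrM normrMsign normr_nat ger0_norm.
Qed.

Lemma decode_coarsen_close r w : 0 <= r ->
  enorm (vsub (decode r w) (decode (2 * r) (coarsen 1 w))) <= Num.sqrt d%:R * r.
Proof.
move=> r0; apply: enorm_le_coord => // l.
rewrite tnth_vsub !tnth_mktuple coarsen_sign coarsenE expn1.
rewrite -!mulrA -mulrBr normrMsign mulrA -mulrBl -natrM.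
rewrite [X in X%:R - _](divn_eq (w l).2 2) natrD addrC addKr.
rewrite normrM normr_nat (ger0_norm r0) ler_piMl // (ler_nat _ _ 1).
by have := ltn_pmod (w l).2 (isT : (0 < 2)%N).
Qed.

Lemma enorm_decode_coarsen i r u : 0 <= r ->
  enorm (decode (2 ^+ i * r) (coarsen i u)) <= enorm (decode r u).
Proof.
move=> r0; apply: ler_enorm => l.
rewrite !abs_decode ?mulr_ge0 ?exprn_ge0 // coarsenE mulrA ler_wpM2r //.
by rewrite -natrX -natrM ler_nat leq_trunc_div.
Qed.

Definition coarse_codes (r rad : R) (i : nat) : {set code} :=
  [set coarsen i u | u in [set u | enorm (decode r u) <= rad]].

(** A code of the ball of radius rad at scale 2^i h has entries of total size at most
M d with M = 2^j, by Cauchy-Schwarz. Hence the product over the coordinates of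
exp(1 - q / M), q being the absolute value of the entry, is at least 1 on such
codes, and their number is at most the sum of this product over all codes. That
sum factorizes into d sums, each at most 2 e (M + 1) <= e^(j + 3). The count is
thus exponential in d with no log d in the exponent. *)
Lemma card_coarse_codes_le (h rad : R) (i j : nat) : (0 < d)%N -> 0 < h ->
  rad = Num.sqrt d%:R * 2 ^+ (i + j) * h ->
  #|coarse_codes h rad i|%:R <= expR (d%:R * (j%:R + 3)) :> R.
Proof.
move=> d0 h0 hE; pose M : R := 2 ^+ j.
have M0 : 0 < M by exact: exprn_gt0.
have sd0 : 0 < Num.sqrt d%:R :> R by rewrite sqrtr_gt0 ltr0n.
(* exponential weight whose product over the coordinates is at least 1 *)
pose wt (v : bool * 'I_m.+1) : R := expR (1 - v.2%:R / M).
have wt_ge1 w : w \in coarse_codes h rad i -> 1 <= \prod_(l < d) wt (w l).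
  case/imsetP => u; rewrite inE => ur ->.
  rewrite -expR_sum -[X in X <= _]expR0 ler_expR sumrB sumr_const card_ord.
  rewrite subr_ge0 -mulr_suml ler_pdivrMr //.
  have := le_trans (sum_abs_le_enorm _) (ler_wpM2l (ltW sd0)
     (le_trans (enorm_decode_coarsen i u (ltW h0)) ur)).
  under eq_bigr => l _ do rewrite abs_decode ?mulr_ge0 ?exprn_ge0 ?(ltW h0) //.
  rewrite -mulr_suml -ler_pdivlMr ?mulr_gt0 ?exprn_gt0 // => /le_trans; apply.
  apply: eq_ler.
  rewrite -[X in _ = X * _](sqr_sqrtr (ler0n R d)) hE /M exprD.
  by field; rewrite !gt_eqF ?exprn_gt0.
apply: (@le_trans _ _ (\sum_(w : code) \prod_(l < d) wt (w l))).
  rewrite -sum1_card natr_sum big_mkcond /=; apply: ler_sum => w _.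
  by case: ifP => [/wt_ge1//|_]; apply: prodr_ge0 => l _; exact: expR_ge0.
rewrite -(bigA_distr_bigA (fun _ => wt)) /= prodr_const card_ord.
rewrite expRM_natl lerXn2r ?nnegrE ?expR_ge0 ?sumr_ge0 //.
  by move=> v _; exact: expR_ge0.
rewrite (_ : \sum_v wt v = \sum_(b : bool) \sum_(q < m.+1) wt (b, q)); last first.
  by rewrite pair_big; apply: eq_bigr => -[].
rewrite big_bool /wt /= -mulr2n.
under eq_bigr do rewrite expRD.
rewrite -mulr_sumr.
have geo := geo_sum_expR_le m.+1 M0.
have e2 : 2 <= expR 1 :> R by have := @expR_ge1Dx R 1.
have Me : M <= expR j%:R.
  by rewrite -[j%:R]mulr1 expRM_natl lerXn2r ?nnegrE ?expR_ge0.
have M1 : 1 <= M by rewrite exprn_ege1 // ler1n.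
rewrite (_ : j%:R + 3 = 1 + (j%:R + (1 + 1))); last by ring.
rewrite expRD -mulrnAr ler_wpM2l ?expR_ge0 // !expRD.
apply: (@le_trans _ _ (M * (2 * 2))); first by move: geo; rewrite -mulr_natr; lra.
by apply: ler_pM; rewrite ?(ltW M0) // ler_pM.
Qed.

End Codes.

(** * Chaining over the dyadic grids *)

Lemma sqrtV_le_rate (R : realType) (k d n : nat) :
  (0 < k)%N -> (0 < d)%N -> (0 < n)%N ->
  (Num.sqrt n%:R)^-1 <= Num.sqrt ((k%:R * d%:R) / n%:R) :> R.
Proof.
move=> k0 d0 n0.
rewrite -sqrtrV ?ler0n // ler_sqrt ?divr_ge0 ?mulr_ge0 ?ler0n //.
by rewrite -natrM ler_pMl ?invr_gt0 ?ltr0n // ler1n muln_gt0 k0.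
Qed.

(** The partial sums are 9 - 2^-J (J + 11/2). *)
Lemma chaining_series_le (R : realFieldType) (J : nat) :
  \sum_(j < J.+1) (2^-1) ^+ j * (j%:R + 7 / 2) <= 9 :> R.
Proof.
suff -> : \sum_(j < J.+1) (2^-1) ^+ j * (j%:R + 7 / 2) =
    9 - (2^-1) ^+ J * (J%:R + 11 / 2) :> R.
  by rewrite gerBl mulr_ge0 ?exprn_ge0 // addr_ge0 // divr_ge0.
elim: J => [|J IH]; first by rewrite big_ord1 /= !expr0; field.
by rewrite big_ord_recr /= IH exprS -natr1; field.
Qed.

Section Chaining.
Variables (R : realType) (d m k n : nat) (h rad : R) (J : nat).
Hypotheses (d_gt0 : (0 < d)%N) (k_gt0 : (0 < k)%N) (n_gt0 : (0 < n)%N).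
Hypotheses (h_gt0 : 0 < h) (radE : rad = Num.sqrt d%:R * 2 ^+ J * h).

Local Notation code := {ffun 'I_d -> bool * 'I_m.+1}.
Local Notation ball_code := {u : code | enorm (decode h u) <= rad}.

Variable p : ball_code -> R.
Hypotheses (p_ge0 : forall b, 0 <= p b) (p_sum1 : \sum_b p b = 1).

Definition code_point (b : ball_code) : Rvec R d := decode h (val b).

Definition code_dist (r : R) (w : {ffun 'I_k -> code}) (b : ball_code) : R :=
  min_dist (code_point b) [tuple decode r (w j) | j < k].

Definition coarsen_book (i : nat) (c : {ffun 'I_k -> ball_code}) :
  {ffun 'I_k -> code} := [ffun j => coarsen i (val (c j))].

Let S : R := Num.sqrt ((k%:R * d%:R) / n%:R).

Let S_gt0 : 0 < S.
Proof. by rewrite sqrtr_gt0 divr_gt0 ?mulr_gt0 ?ltr0n. Qed.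

Let nS2 : n%:R * S ^+ 2 = k%:R * d%:R.
Proof.
rewrite sqr_sqrtr; first by rewrite mulrC divfK // pnatr_eq0 -lt0n.
by rewrite divr_ge0 // mulr_ge0.
Qed.

Let rad_gt0 : 0 < rad.
Proof. by rewrite radE !mulr_gt0 ?exprn_gt0 ?sqrtr_gt0 ?ltr0n. Qed.

(** One level of the chain. The optimal exponent in [iid_mean_max_dev_le] balances
log-cardinality k d (j + 3) against variance; t = 2^j sqrt(k d n) / rad has the
right order and avoids a square root of j + 3. *)
Lemma chaining_level (i j : nat) (Y : {ffun 'I_k -> code} -> ball_code -> R)
    (cs : seq ball_code -> {ffun 'I_k -> ball_code}) :
  (i + j)%N = J ->
  (forall w : {ffun 'I_k -> code}, (forall l, w l \in coarse_codes d m h rad i) ->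
     forall a b, Y w a - Y w b <= 2 * ((2^-1) ^+ j * rad)) ->
  iid_mean p n (fun s => dev p n (Y (coarsen_book i (cs s))) s) <=
  rad * S * ((2^-1) ^+ j * (j%:R + 7 / 2)).
Proof.
move=> ijJ Yc.
(* n S = sqrt (k d n) *)
pose t := 2 ^+ j * n%:R * S / rad.
have t0 : 0 < t by rewrite divr_gt0 // !mulr_gt0 ?exprn_gt0 ?ltr0n.
have L := @card_coarse_codes_le R d m h rad i j d_gt0 h_gt0.
rewrite ijJ in L; have {}L := L radE.
pose U := [set w : {ffun 'I_k -> code} in ffun_on (coarse_codes d m h rad i)].
have UL : #|U|%:R <= expR (k%:R * (d%:R * (j%:R + 3))) :> R.
  by rewrite /U cardsE card_ffun_on card_ord natrX expRM_natl lerXn2r ?nnegrE ?expR_ge0.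
have := @iid_mean_max_dev_le R _ p p_ge0 p_sum1 n _ U Y
  (fun s => coarsen_book i (cs s)) _ _ t n_gt0 t0 _ UL _.
move=> /(_ (2 * ((2^-1) ^+ j * rad))) H.
apply: le_trans (H _ _) _.
- move=> s; rewrite inE; apply/ffun_onP => l; rewrite ffunE.
  by apply: imset_f; rewrite inE; exact: (valP (cs s l)).
- by move=> w; rewrite inE => /ffun_onP; exact: Yc.
rewrite mulrA -nS2; apply: eq_ler.
rewrite /t exprVn; field.
by rewrite !gt_eqF ?exprn_gt0 ?ltr0n.
Qed.

(** Chaining along the successive coarsenings of the chosen codebook: each link
compares a codebook with its image under one more coarsening, and the chain ends
at the coarsest grid, of mesh rad / sqrt d; there the distance itself, of range
2 rad, plays the role of a link. *)
Lemma expected_max_deviation_le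
    (cs : seq ball_code -> {ffun 'I_k -> ball_code}) :
  iid_mean p n (fun s => dev p n (code_dist h (coarsen_book 0 (cs s))) s) <=
  9 * rad * S.
Proof.
pose r i := 2 ^+ i * h.
have r0 i : 0 <= r i by rewrite mulr_ge0 ?exprn_ge0 // ltW.
(* link number i, a function of its finer endpoint alone *)
pose Y i (w : {ffun 'I_k -> code}) b :=
  code_dist (r i) w b - code_dist (r i.+1) [ffun j => coarsen 1 (w j)] b.
have telescope s c : dev p n (code_dist h (coarsen_book 0 c)) s =
    \sum_(i < J) dev p n (Y i (coarsen_book i c)) s +
    dev p n (code_dist (r J) (coarsen_book J c)) s.
  rewrite -(big_mkord predT (fun i => dev p n (Y i (coarsen_book i c)) s)).
  rewrite (@telescope_sumr_eq _ _ _
     (fun i => - dev p n (code_dist (r i) (coarsen_book i c)) s)) //.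
    by rewrite /r expr0 mul1r opprK addrAC addNr add0r.
  move=> i _; rewrite opprK addrC.
  rewrite /Y (_ : [ffun j => _] = coarsen_book i.+1 c); first by rewrite devB.
  by apply/ffunP => j; rewrite !ffunE -coarsenS.
rewrite (eq_iid_mean _ _ (fun s => telescope s (cs s))).
rewrite iid_meanD iid_mean_sum.
have level (i : 'I_J) :
    iid_mean p n (fun s => dev p n (Y i (coarsen_book i (cs s))) s) <=
    rad * S * ((2^-1) ^+ (J - i) * ((J - i)%:R + 7 / 2)).
  apply: (@chaining_level i (J - i)%N); first by rewrite subnKC // ltnW.
  move=> w _.
  have step b : `|Y i w b| <= (2^-1) ^+ (J - i) * rad.
    rewrite /Y /code_dist; apply: (@le_trans _ _ (0 + Num.sqrt d%:R * r i)).
      apply: min_dist_close => //.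
        rewrite (_ : vsub _ _ = [tuple 0 | _ < d]); last first.
          by apply: eq_from_tnth => l; rewrite !tnth_mktuple subrr.
        rewrite /enorm big1 ?sqrtr0 // => l _.
        by rewrite tnth_mktuple expr0n.
      move=> j; rewrite !tnth_mktuple ffunE /r exprS -mulrA.
      by apply: decode_coarsen_close; exact: r0.
    rewrite add0r; apply: eq_ler.
    rewrite radE /r (_ : 2 ^+ J = 2 ^+ (J - i) * 2 ^+ i); last first.
      by rewrite -exprD subnK // ltnW.
    rewrite exprVn.
    by field; rewrite gt_eqF ?exprn_gt0.
  move=> a b; have := step a; have := step b; rewrite !ler_norml; lra.
have last : iid_mean p n (fun s => dev p n (code_dist (r J) (coarsen_book J (cs s))) s)
    <= rad * S * ((2^-1) ^+ 0 * (0%:R + 7 / 2)).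
  apply: (@chaining_level J 0); first by rewrite addn0.
  move=> w wP a b; rewrite expr0 mul1r.
  have h1 : code_dist (r J) w a <= 2 * rad.
    apply: min_dist_le_radius => //; first exact: (valP a).
    move=> j; rewrite tnth_mktuple.
    have /imsetP[u] := wP j; rewrite inE => ur ->.
    by apply: le_trans ur; apply: enorm_decode_coarsen; exact: ltW.
  have h2 : 0 <= code_dist (r J) w b by exact: min_dist_ge0.
  by move: h1 h2; lra.
apply: le_trans (lerD (ler_sum _ (fun i _ => level i)) last) _.
rewrite -mulr_sumr -mulrDr.
rewrite (reindex_inj rev_ord_inj) /=.
rewrite (eq_bigr (fun i : 'I_J => (2^-1) ^+ i.+1 * (i.+1%:R + 7 / 2))); last first.
  by move=> i _; rewrite subKn.
have := @chaining_series_le R J; rewrite big_ord_recl /=.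
rewrite (addrC (_ * _)) => /(ler_wpM2l (mulr_ge0 (ltW rad_gt0) (ltW S_gt0))).
by move=> /le_trans; apply; rewrite mulrC mulrA.
Qed.


Variable b0 : ball_code.

Definition book_dist (c : {ffun 'I_k -> ball_code}) (b : ball_code) : R :=
  min_dist (code_point b) [tuple code_point (c j) | j < k].

Lemma book_distE c : code_dist h (coarsen_book 0 c) = book_dist c.
Proof.
apply/funext => b; congr min_dist; apply: eq_from_tnth => j.
by rewrite !tnth_mktuple ffunE coarsen0.
Qed.

Lemma book_dist_range c a b : book_dist c a - book_dist c b <= 2 * rad.
Proof.
have h1 : book_dist c a <= 2 * rad.
  apply: min_dist_le_radius => //; first exact: (valP a).
  by move=> j; rewrite tnth_mktuple; exact: (valP (c j)).
have h2 : 0 <= book_dist c b by exact: min_dist_ge0.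
by move: h1 h2; lra.
Qed.

Definition worst_book (s : seq ball_code) : {ffun 'I_k -> ball_code} :=
  [arg max_(c > [ffun=> b0]) dev p n (book_dist c) s]%O.

Definition max_dev (s : seq ball_code) : R := dev p n (book_dist (worst_book s)) s.

Lemma max_dev_ub c s : dev p n (book_dist c) s <= max_dev s.
Proof. by rewrite /max_dev /worst_book; case: arg_maxP => // i _; exact. Qed.

(** A maximum of functions with bounded differences has the same property:
compare both samples at the worst codebook of the first one. *)
Lemma max_dev_bounded_differences : bounded_differences max_dev (2 * rad / n%:R).
Proof.
move=> s1 a b s2.
apply: (le_trans (lerB (lexx _) (max_dev_ub (worst_book (s1 ++ a :: s2)) _))).
apply: (@dev_bounded_differences R _ p n _ (2 * rad)).
exact: book_dist_range.
Qed.

Lemma iid_mean_max_dev :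
  iid_mean p n max_dev <= 9 * rad * Num.sqrt ((k%:R * d%:R) / n%:R).
Proof.
apply: le_trans (expected_max_deviation_le worst_book).
apply: eq_ler; apply: eq_iid_mean => s.
by rewrite book_distE.
Qed.

(** Concentration around the mean, with the mean bounded by chaining; the
difference 10 - 9 pays for the margin of one standard deviation. *)
Lemma max_dev_excess_le (x M : R) : 0 <= x ->
  rad * (10 * Num.sqrt ((k%:R * d%:R) / n%:R)
         + 2 * Num.sqrt (x / (2 * n%:R))) <= M ->
  iid_mean p n (fun s => Num.max 0 (max_dev s - M)) <=
  expR (- x) * (rad / Num.sqrt n%:R).
Proof.
move=> x0 HM.
have rad0 : 0 < rad by rewrite radE !mulr_gt0 ?exprn_gt0 ?sqrtr_gt0 ?ltr0n.
apply: iid_mean_excess_gauss => //; first exact: max_dev_bounded_differences.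
have kd := sqrtV_le_rate R k_gt0 d_gt0 n_gt0.
have := ler_wpM2l (ltW rad0) kd.
have := iid_mean_max_dev; move: HM; lra.
Qed.

End Chaining.

(** * Measurability and finite-valued random variables *)

(** The product form of the expectation, which is what independence provides. *)
Lemma iid_mean_tuple (R : realType) (B : finType) (p : B -> R) n (f : seq B -> R) :
  iid_mean p n f = \sum_(t : n.-tuple B) (\prod_(b <- t) p b) * f t.
Proof.
elim: n f => [|n IH] f /=.
  rewrite (big_pred1 [tuple]); last first.
    by move=> t; apply/esym/eqP; exact: tuple0.
  by rewrite big_nil mul1r.
pose g (u : B * n.-tuple B) : n.+1.-tuple B := [tuple of u.1 :: u.2].
rewrite (reindex g) /=; last first.
  exists (fun t : n.+1.-tuple B => (thead t, [tuple of behead t])).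
    by move=> [b t] _; congr (_, _); apply: val_inj.
  by move=> t _; rewrite [t in RHS]tuple_eta.
rewrite -(pair_big predT predT
  (fun b (t : n.-tuple B) => (\prod_(b' <- g (b, t)) p b') * f (g (b, t)))) /=.
apply: eq_bigr => b _; rewrite IH mulr_sumr; apply: eq_bigr => t _.
by rewrite big_cons mulrA.
Qed.

Section FiniteValued.
Variables (disp : measure_display) (T : measurableType disp) (R : realType).
Variable P : probability T R.

Lemma ge0_integral_finite (B : finType) (Y : T -> B) (phi : B -> R) :
  (forall b, measurable (Y @^-1` [set b])) -> (forall b, 0 <= phi b) ->
  measurable_fun [set: T] (fun w => (phi (Y w))%:E) /\
  (\int[P]_w (phi (Y w))%:E = \sum_b (phi b)%:E * P (Y @^-1` [set b]))%E.
Proof.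
move=> mY phi0.
have E w : (phi (Y w))%:E = (\sum_(b : B) (phi b * \1_(Y @^-1` [set b]) w)%:E)%E.
  rewrite sumEFin; congr EFin; rewrite (bigD1 (Y w)) //= indicE mem_set //.
  rewrite mulr1 big1 ?addr0 // => b bY; rewrite indicE memNset ?mulr0 //=.
  by move=> Yb; rewrite Yb eqxx in bY.
have mi b : measurable_fun [set: T] (fun w => (phi b * \1_(Y @^-1` [set b]) w)%:E).
  apply/measurable_EFinP; apply: measurable_funM => //.
rewrite (_ : (fun w => _) = (fun w =>
  \sum_(b : B) (phi b * \1_(Y @^-1` [set b]) w)%:E)%E); last exact/funext.
split; first exact: emeasurable_sum.
rewrite ge0_integral_sum //; last first.
  by move=> b w _; rewrite lee_fin mulr_ge0.
apply: eq_bigr => b _.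
rewrite (eq_integral (fun w => (phi b)%:E * (\1_(Y @^-1` [set b]) w)%:E)%E) //.
rewrite ge0_integralZl_EFin //; last first.
  by apply/measurable_EFinP; exact: measurable_indic.
by rewrite integral_indic // setIT.
Qed.

End FiniteValued.

Section Measurability.
Variables (R : realType) (d : nat).

Lemma measurable_sqrt : measurable_fun [set: measurableTypeR R]
  (Num.sqrt : measurableTypeR R -> measurableTypeR R).
Proof. by apply: continuous_measurable_fun; exact: sqrt_continuous. Qed.

Lemma measurable_enorm : measurable_fun [set: Rvec R d] (@enorm R d).
Proof.
apply: (measurableT_comp measurable_sqrt).
apply: measurable_sum => i; apply: measurable_funX; exact: measurable_tnth.
Qed.

Lemma measurable_vsub (c : Rvec R d) :
  measurable_fun [set: Rvec R d] (fun x => vsub x c).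
Proof.
apply/measurable_fun_tnthP => i.
rewrite (_ : _ \o _ = fun x => tnth x i - tnth c i); last first.
  by apply/funext => x /=; rewrite tnth_vsub.
by apply: measurable_funB => //; exact: measurable_tnth.
Qed.

Lemma measurable_min_dist k (c : k.-tuple (Rvec R d)) :
  measurable_fun [set: Rvec R d] (fun x => min_dist x c).
Proof.
case: k c => [c|k c].
  rewrite (_ : (fun x => _) = cst 0); first exact: measurable_cst.
  apply/funext => x; rewrite /min_dist (_ : [set _ | _ in _] = set0) ?inf0 //.
  by rewrite -subset0 => y [] [] j.
pose f (j : 'I_k.+1) x : R := enorm (vsub x (tnth c j)).
have mf j : measurable_fun [set: Rvec R d] (f j).
  exact: (measurableT_comp measurable_enorm (measurable_vsub _)).
rewrite (_ : (fun x => _) = (fun x => \big[Num.min/f ord0 x]_j f j x)).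
  elim: (index_enum _) => [|j s IH].
    by rewrite (_ : (fun x => _) = f ord0) //; apply/funext => x; rewrite big_nil.
  rewrite (_ : (fun x => _) = (f j \min (fun x => \big[Num.min/f ord0 x]_(j <- s) f j x))).
    exact: measurable_minr.
  by apply/funext => x; rewrite big_cons.
apply/funext => x; apply/eqP; rewrite eq_le; apply/andP; split.
  elim/big_ind: _ => [|a b ha hb|j _]; [exact: min_dist_lb| |exact: min_dist_lb].
  by rewrite le_min ha.
by apply: le_min_dist => // j; exact: bigmin_le.
Qed.

End Measurability.

(** * Rounding to the grid *)

Section Quantizer.
Variables (R : realType) (d m : nat) (h rad : R).
Hypotheses (h_gt0 : 0 < h).

Local Notation code := {ffun 'I_d -> bool * 'I_m.+1}.
Local Notation ball_code := {u : code | enorm (decode h u) <= rad}.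

Variable b0 : ball_code.

Definition encode (x : Rvec R d) : code :=
  [ffun l => (tnth x l < 0, inord (Num.truncn (`|tnth x l| / h)))].

(** Points whose code leaves the ball are sent to b0; those of the ball of radius
rad keep their code. *)
Definition quantize (x : Rvec R d) : ball_code := insubd b0 (encode x).

(** Truncation towards zero loses at most one mesh per coordinate and never
increases absolute values, so the ball is mapped into itself. *)
Lemma decode_encode_coord (x : Rvec R d) l : `|tnth x l| < m.+1%:R * h ->
  `|tnth (decode h (encode x)) l| <= `|tnth x l| /\
  `|tnth (vsub x (decode h (encode x))) l| <= h.
Proof.
set y := tnth x l => ym.
have y0 : 0 <= `|y| / h by rewrite divr_ge0 // ltW.
have /andP[qy yq] := truncn_itv y0.
set q := Num.truncn _ in qy yq.
have qm : (q < m.+1)%N.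
  by rewrite -(ltr_nat R) (le_lt_trans qy) // ltr_pdivrMr.
have E : ((encode x l).2 = q :> nat) by rewrite ffunE /= inordK.
have qhy : q%:R * h <= `|y| by rewrite -ler_pdivlMr.
have yqh : `|y| < q%:R * h + h.
  by move: yq; rewrite ltr_pdivrMr // -natr1 mulrDl mul1r.
split; first by rewrite abs_decode ?(ltW h_gt0) // E.
rewrite tnth_vsub tnth_mktuple E (_ : (encode x l).1 = (y < 0)); last by rewrite ffunE.
rewrite -/y; move: qhy yqh; case: (ltP y 0) => [yl0|y_ge0].
  by rewrite expr1 (ltr0_norm yl0) ler_norml => ? ?; apply/andP; split; lra.
by rewrite expr0 (ger0_norm y_ge0) ler_norml => ? ?; apply/andP; split; lra.
Qed.

Lemma quantize_close (x : Rvec R d) : rad < m.+1%:R * h -> enorm x <= rad ->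
  enorm (vsub x (code_point (quantize x))) <= Num.sqrt d%:R * h.
Proof.
move=> radm xr.
have coord l : `|tnth x l| < m.+1%:R * h.
  by apply: le_lt_trans radm; apply: le_trans xr; exact: coord_le_enorm.
rewrite /code_point /quantize val_insubd ifT; last first.
  apply: le_trans xr; apply: ler_enorm => l.
  by have [] := decode_encode_coord (coord l).
apply: enorm_le_coord; first exact: ltW.
by move=> l; have [] := decode_encode_coord (coord l).
Qed.

Lemma measurable_encode_fiber (u : code) : measurable (encode @^-1` [set u]).
Proof.
pose A l (y : measurableTypeR R) : Prop :=
  (y < 0, inord (Num.truncn (`|y| / h))) = u l.
rewrite (_ : _ @^-1` _ = \bigcap_(l in [set: 'I_d])
    ((fun x => tnth x l) @^-1` (A l))); last first.
  apply/seteqP; split => x /=; first by move=> E l _; rewrite /A /= -E ffunE.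
  by move=> xA; apply/ffunP => l; rewrite ffunE; exact: xA.
apply: fin_bigcap_measurable => // l _.
rewrite -[_ @^-1` _]setTI; apply: measurable_tnth => //.
pose C N : set (measurableTypeR R) := [set y | `|y| / h \in `[N%:R, N.+1%:R[].
rewrite (_ : A l = [set y | y \in `]-oo, 0[ = (u l).1] `&`
  \bigcup_(N in [set N | inord N = (u l).2]) C N); last first.
  apply/seteqP; split => y.
    rewrite /A => E; split; first by rewrite -E /= in_itv.
    exists (Num.truncn (`|y| / h)); first by rewrite -E.
    by rewrite /C /= in_itv /= truncn_itv // divr_ge0 // ltW.
  move=> [/= yl [N NE]]; rewrite /C /= in_itv /= => yN.
  rewrite /A [RHS]surjective_pairing -yl in_itv /= -NE; congr (_, inord _).
  by apply/truncn_def.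
apply: measurableI.
  case: (u l).1.
    by apply: measurable_itv.
  rewrite (_ : [set _ | _] = ~` `]-oo, 0[); first by apply: measurableC; exact: measurable_itv.
  by apply/seteqP; split => y /=; [move=> ->|move/negP/negbTE].
apply: bigcup_measurable => N _.
rewrite -[C N]setTI.
have mf : measurable_fun [set: measurableTypeR R]
    (fun y : measurableTypeR R => `|y| / h : measurableTypeR R).
  apply: measurable_funM => //; exact: normr_measurable.
exact: (mf measurableT _ (measurable_itv `[N%:R, N.+1%:R[)).

Qed.

Lemma measurable_quantize_fiber (b : ball_code) :
  measurable (quantize @^-1` [set b]).
Proof.
rewrite (_ : _ @^-1` _ = \bigcup_(u in [set u : code | insubd b0 u = b])
    (encode @^-1` [set u])).
  apply: fin_bigcup_measurable => // u _; exact: measurable_encode_fiber.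
apply/seteqP; split => x /=; first by move=> xb; exists (encode x).
by move=> [u /= ub xu]; rewrite /quantize xu.
Qed.

End Quantizer.

(** * From the sample to its rounding *)

Section IntegralBound.
Local Open Scope ereal_scope.
Variables (disp : measure_display) (T : measurableType disp) (R : realType).
Variable P : probability T R.

(** The integral of a nonnegative function is a supremum over the simple functions
below it, so monotonicity needs measurability of the upper function only. This
spares the measurability of the distortion at a random codebook. *)
Lemma ge0_integral_le_off_null (f g : T -> \bar R) (N : set T) :
  measurable N -> P N = 0 -> (forall w, 0 <= f w) -> (forall w, 0 <= g w) ->
  measurable_fun [set: T] g -> (forall w, ~ N w -> f w <= g w) ->
  \int[P]_w f w <= \int[P]_w g w.
Proof.
move=> mN N0 f0 g0 mg fg; rewrite ge0_integralTE //.
apply: ge_ereal_sup => _ [s sf <-].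
rewrite -integralT_nnsfun; apply: ae_ge0_le_integral => //.
- by move=> w _; rewrite lee_fin fun_ge0.
- exact/measurable_EFinP.
exists N; split => // w /= nsg; apply: contrapT => Nw; apply: nsg => _.
exact: le_trans (sf w) (fg w Nw).
Qed.

End IntegralBound.

Section Transfer.
Variables (R : realType) (d n : nat) (rad : R).
Variables (disp : measure_display) (T : measurableType disp) (P : probability T R).
Variables (X : {RV P >-> Rvec R d}) (Xs : 'I_n -> {RV P >-> Rvec R d}).
Hypotheses (d_gt0 : (0 < d)%N) (n_gt0 : (0 < n)%N) (rad_gt0 : 0 < rad).
Hypothesis X_ball : {ae P, forall w, enorm (X w) <= rad}.
Hypothesis Xs_law : forall i, same_law (Xs i) X.
Hypothesis Xs_indep : mutually_independent P (fun i w => Xs i w).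

(** With n halvings of the coarsest mesh, the rounding error rad / 2^n is small
compared to rad / sqrt n. *)
Definition mesh : R := rad / (Num.sqrt d%:R * 2 ^+ n).

Local Notation m := (2 ^ n * d)%N.
Local Notation ball_code :=
  {u : {ffun 'I_d -> bool * 'I_m.+1} | enorm (decode mesh u) <= rad}.

Lemma mesh_gt0 : 0 < mesh.
Proof. by rewrite divr_gt0 // mulr_gt0 ?exprn_gt0 ?sqrtr_gt0 ?ltr0n. Qed.

Lemma radius_mesh : rad = Num.sqrt d%:R * 2 ^+ n * mesh.
Proof.
rewrite /mesh mulrC divfK // gt_eqF // mulr_gt0 ?exprn_gt0 ?sqrtr_gt0 ?ltr0n //.
Qed.

Lemma radius_lt_grid : rad < m.+1%:R * mesh.
Proof.
rewrite [X in X < _]radius_mesh ltr_pM2r ?mesh_gt0 //.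
apply: (@le_lt_trans _ _ m%:R); last by rewrite ltr_nat.
rewrite natrM natrX mulrC ler_wpM2l ?exprn_ge0 //.
have d1 : 1 <= Num.sqrt d%:R :> R by rewrite -[X in X <= _]sqrtr1 ler_sqrt ?ler1n.
rewrite -[X in _ <= X](sqr_sqrtr (ler0n R d)) expr2 ler_peMl // sqrtr_ge0.
Qed.

Lemma zero_code_in_ball :
  enorm (decode mesh [ffun _ : 'I_d => (false, @ord0 m)]) <= rad.
Proof.
rewrite /enorm big1 ?sqrtr0 ?(ltW rad_gt0) // => l _.
by rewrite tnth_mktuple ffunE mulr0 mul0r expr0n.
Qed.

Definition zero_code : ball_code :=
  exist (fun u => is_true (enorm (decode mesh u) <= rad)) _ zero_code_in_ball.

Definition grid_point (x : Rvec R d) : ball_code := quantize zero_code x.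

Definition grid_error : R := rad / 2 ^+ n.

Lemma grid_point_close x : enorm x <= rad ->
  enorm (vsub x (code_point (grid_point x))) <= grid_error.
Proof.
move=> xr; apply: le_trans (quantize_close mesh_gt0 zero_code radius_lt_grid xr) _.
rewrite /grid_error [X in _ <= X / _]radius_mesh; apply: eq_ler.
by field; rewrite gt_eqF // exprn_gt0.
Qed.

Lemma measurable_grid_fiber b : measurable (grid_point @^-1` [set b]).
Proof. exact: measurable_quantize_fiber mesh_gt0 _ _. Qed.

Definition grid_law (b : ball_code) : R :=
  fine (P (X @^-1` (grid_point @^-1` [set b]))).

Lemma measurable_X_fiber (Y : {RV P >-> Rvec R d}) b :
  measurable (Y @^-1` (grid_point @^-1` [set b])).
Proof.
rewrite -[_ @^-1` _]setTI.
exact: (measurable_funPT Y measurableT _ (measurable_grid_fiber b)).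
Qed.

Lemma grid_lawE b : P (X @^-1` (grid_point @^-1` [set b])) = (grid_law b)%:E.
Proof.
rewrite /grid_law fineK // fin_num_measure //; exact: measurable_X_fiber.
Qed.

Lemma grid_law_ge0 b : 0 <= grid_law b.
Proof. by rewrite fine_ge0. Qed.

Lemma grid_mean (phi : ball_code -> R) : (forall b, 0 <= phi b) ->
  measurable_fun [set: T] (fun w => (phi (grid_point (X w)))%:E) /\
  (\int[P]_w (phi (grid_point (X w)))%:E = (mean grid_law phi)%:E)%E.
Proof.
move=> phi0.
have [mphi iphi] := @ge0_integral_finite _ _ _ P _ (grid_point \o X) phi
  (measurable_X_fiber X) phi0.
split => //; rewrite iphi /mean -sumEFin; apply: eq_bigr => b _.
by rewrite comp_preimage grid_lawE -EFinM mulrC.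
Qed.

Lemma grid_law_sum1 : \sum_b grid_law b = 1.
Proof.
have [//|_] := @grid_mean (fun=> 1).
rewrite integral_cst // [X in (_ * X)%E](probability_setT P) mul1e => -[].
by rewrite /mean => ->; apply: eq_bigr => b _; rewrite mulr1.
Qed.

Definition grid_sample (w : T) : n.-tuple ball_code :=
  [tuple grid_point (Xs i w) | i < n].

(** The only use of independence: the fiber of a tuple of grid points is an
intersection of one event per observation. *)
Lemma grid_sample_mean (phi : seq ball_code -> R) : (forall s, 0 <= phi s) ->
  measurable_fun [set: T] (fun w => (phi (grid_sample w))%:E) /\
  (\int[P]_w (phi (grid_sample w))%:E = (iid_mean grid_law n phi)%:E)%E.
Proof.
move=> phi0.
have fiberE (t : n.-tuple ball_code) : grid_sample @^-1` [set t] =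
    [set w | forall i, (grid_point @^-1` [set tnth t i]) (Xs i w)].
  apply/seteqP; split => w /=.
    by move=> E i; rewrite -E tnth_mktuple.
  by move=> H; apply: eq_from_tnth => i; rewrite tnth_mktuple.
have mfiber (t : n.-tuple ball_code) : measurable (grid_sample @^-1` [set t]).
  rewrite (_ : _ @^-1` _ = \bigcap_(i in [set: 'I_n])
    (Xs i @^-1` (grid_point @^-1` [set tnth t i]))).
    by apply: fin_bigcap_measurable => // i _; exact: measurable_X_fiber.
  by rewrite fiberE; apply/seteqP; split => w /= H i => [_|]; exact: H.
have [mphi iphi] := @ge0_integral_finite _ _ _ P _ grid_sample
  (fun t => phi (tval t)) mfiber (fun t => phi0 t).
split => //; rewrite iphi iid_mean_tuple -sumEFin; apply: eq_bigr => t _.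
rewrite mulrC EFinM; congr (_ * _)%E.
rewrite fiberE (Xs_indep (fun i => measurable_grid_fiber (tnth t i))).
rewrite big_tuple -prodEFin; apply: eq_bigr => i _.
by rewrite -grid_lawE; apply: Xs_law; exact: measurable_grid_fiber.
Qed.

Definition grid_book k (c : k.-tuple (Rvec R d)) : {ffun 'I_k -> ball_code} :=
  [ffun j => grid_point (tnth c j)].

Lemma min_dist_grid k x (c : k.-tuple (Rvec R d)) : (0 < k)%N ->
  enorm x <= rad -> (forall j, enorm (tnth c j) <= rad) ->
  `|min_dist x c - book_dist (grid_book c) (grid_point x)| <= 2 * grid_error.
Proof.
move=> k0 xr cr; rewrite mulr_natl mulr2n; apply: min_dist_close => //.
  exact: grid_point_close.
by move=> j; rewrite tnth_mktuple ffunE; apply: grid_point_close.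
Qed.

Lemma grid_error_ge0 : 0 <= grid_error.
Proof. by rewrite divr_ge0 ?exprn_ge0 // ltW. Qed.

Lemma measurable_min_dist_RV (Y : {RV P >-> Rvec R d}) k (c : k.-tuple (Rvec R d)) :
  measurable_fun [set: T] (fun w => min_dist (Y w) c).
Proof.
exact: (measurableT_comp (measurable_min_dist c) (measurable_funPT Y)).
Qed.

Lemma distortionE k (c : k.-tuple (Rvec R d)) :
  distortion P X c = (\int[P]_w (min_dist (X w) c)%:E)%E.
Proof. by rewrite /distortion unlock. Qed.

Lemma distortion_le_grid k (c : k.-tuple (Rvec R d)) : (0 < k)%N ->
  (forall j, enorm (tnth c j) <= rad) ->
  (distortion P X c <=
   (mean grid_law (book_dist (grid_book c)) + 2 * grid_error)%:E)%E.
Proof.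
move=> k0 cr; rewrite distortionE.
pose phi b := book_dist (grid_book c) b + 2 * grid_error.
have phi0 b : 0 <= phi b.
  by rewrite addr_ge0 ?min_dist_ge0 // mulr_ge0 // grid_error_ge0.
have [mphi iphi] := grid_mean phi0.
rewrite -[in leRHS](mean_cst grid_law_sum1 (2 * grid_error)) -meanD.
rewrite -iphi; apply: ae_ge0_le_integral => //.
- by move=> w _; rewrite lee_fin min_dist_ge0.
- by apply/measurable_EFinP; exact: measurable_min_dist_RV.
- by move=> w _; rewrite lee_fin.
apply: filterS X_ball => w Xw _; rewrite lee_fin /phi.
by have := min_dist_grid k0 Xw cr; rewrite ler_norml => /andP[_]; lra.
Qed.

Definition outside_ball : set T :=
  \bigcup_(i in [set: 'I_n]) (Xs i @^-1` [set x | ~~ (enorm x <= rad)]).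

Let measurable_outside : measurable [set x : Rvec R d | ~~ (enorm x <= rad)].
Proof.
rewrite (_ : [set _ | _] = [set: Rvec R d] `&` (@enorm R d) @^-1` `]rad, +oo[).
  by apply: measurable_enorm => //; exact: measurable_itv.
rewrite setTI; apply/seteqP; split => x /=; by rewrite in_itv /= andbT ltNge.
Qed.

Lemma outside_ball_null : measurable outside_ball /\ P outside_ball = 0%E.
Proof.
have mi i : measurable (Xs i @^-1` [set x | ~~ (enorm x <= rad)]).
  rewrite -[_ @^-1` _]setTI.
  exact: (measurable_funPT (Xs i) measurableT _ measurable_outside).
have mo : measurable outside_ball by apply: fin_bigcup_measurable.
split => //.
have Xi0 i : P (Xs i @^-1` [set x | ~~ (enorm x <= rad)]) = 0%E.
  rewrite (Xs_law i measurable_outside : P _ = P _).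
  case: X_ball => N [mN N0 XN]; apply: (subset_measure0 _ mN _ N0).
    rewrite -[_ @^-1` _]setTI.
    exact: (measurable_funPT X measurableT _ measurable_outside).
  by move=> w /= Xw; apply: XN => /= ; apply/negP.
apply/measure_negligible => //.
rewrite (_ : outside_ball = \big[setU/set0]_(i <- enum 'I_n)
    (Xs i @^-1` [set x | ~~ (enorm x <= rad)])).
  elim/big_ind: _ => [|A B|i _]; first exact: negligible_set0.
    exact: negligibleU.
  by apply/negligibleP; [exact: mi|exact: Xi0].
rewrite -bigcup_seq (_ : [set` enum 'I_n] = [set: 'I_n]) //.
by apply/seteqP; split => i //= _; rewrite mem_enum.
Qed.

(** Rounding costs 2 [grid_error] on each side: one [grid_error] for the observation
and one for the centers, in the mean and in the empirical mean. *)
Lemma distortion_le_emp w k (c : k.-tuple (Rvec R d)) : (0 < k)%N ->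
  (forall j, enorm (tnth c j) <= rad) -> ~ outside_ball w ->
  (distortion P X c <=
   (emp_distortion (sample (fun i => Xs i) w) c +
    max_dev k n grid_law zero_code (grid_sample w) +
    4 * grid_error)%:E)%E.
Proof.
move=> k0 cr good; apply: le_trans (distortion_le_grid k0 cr) _; rewrite lee_fin.
have := max_dev_ub n grid_law zero_code (grid_book c) (grid_sample w).
set M := max_dev _ _ _ _ _; set mu := mean _ _.
have Xw i : enorm (Xs i w) <= rad.
  by apply: contrapT => /negP Xi; apply: good; exists i.
have close i : book_dist (grid_book c) (grid_point (Xs i w)) <=
    min_dist (Xs i w) c + 2 * grid_error.
  by have := min_dist_grid k0 (Xw i) cr; rewrite ler_norml => /andP[+ _]; lra.
rewrite /dev big_tuple /emp_distortion.
have nn0 : n%:R != 0 :> R by rewrite pnatr_eq0 -lt0n.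
have -> : n%:R^-1 * \sum_(i < n) (mean grid_law (book_dist (grid_book c)) -
    book_dist (grid_book c) (tnth (grid_sample w) i)) =
    mu - n%:R^-1 * \sum_(i < n) book_dist (grid_book c) (grid_point (Xs i w)).
  rewrite sumrB sumr_const card_ord -/mu mulrBr -[mu *+ n]mulr_natl mulKf //.
  by under eq_bigr do rewrite tnth_mktuple.
have : n%:R^-1 * \sum_(i < n) book_dist (grid_book c) (grid_point (Xs i w)) <=
    n%:R^-1 * \sum_(i < n) min_dist (tnth (sample (fun i => Xs i) w) i) c
    + 2 * grid_error.
  rewrite -[X in _ + X](mulKf nn0) -mulrDr ler_wpM2l ?invr_ge0 //.
  rewrite (_ : n%:R * _ = \sum_(i < n) 2 * grid_error); last first.
    by rewrite sumr_const card_ord mulr_natl.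
  rewrite -big_split /=.
  by apply: ler_sum => i _; rewrite tnth_mktuple.
lra.
Qed.

Lemma emp_distortion_mean k (c : k.-tuple (Rvec R d)) :
  measurable_fun [set: T]
    (fun w => (emp_distortion (sample (fun i => Xs i) w) c)%:E) /\
  (\int[P]_w (emp_distortion (sample (fun i => Xs i) w) c)%:E =
   distortion P X c)%E.
Proof.
have E w : (emp_distortion (sample (fun i => Xs i) w) c)%:E =
    ((n%:R^-1)%:E * \sum_(i < n) (min_dist (Xs i w) c)%:E)%E.
  rewrite /emp_distortion EFinM sumEFin; congr (_ * (_)%:E)%E.
  by apply: eq_bigr => i _; rewrite tnth_mktuple.
have mi i : measurable_fun [set: T] (fun w => (min_dist (Xs i w) c)%:E).
  by apply/measurable_EFinP; exact: measurable_min_dist_RV.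
have ms : measurable_fun [set: T] (fun w => \sum_(i < n) (min_dist (Xs i w) c)%:E)%E.
  exact: emeasurable_sum.
rewrite (_ : (fun w => _) = (fun w => (n%:R^-1)%:E *
  \sum_(i < n) (min_dist (Xs i w) c)%:E)%E); last exact/funext.
split; first exact: measurable_funeM.
rewrite ge0_integralZl_EFin ?invr_ge0 //; last first.
  by move=> w _; apply: sume_ge0 => i _; rewrite lee_fin min_dist_ge0.
rewrite ge0_integral_sum //; last by move=> i w _; rewrite lee_fin min_dist_ge0.
rewrite (eq_bigr (fun=> distortion P X c)); last first.
  move=> i _; rewrite distortionE.
  have md : measurable_fun [set: Rvec R d] (fun x => (min_dist x c)%:E).
    by apply/measurable_EFinP; exact: measurable_min_dist.
  have md0 (x : Rvec R d) : (0 <= (min_dist x c)%:E)%E by rewrite lee_fin min_dist_ge0.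
  rewrite -(ge0_integral_distribution (Xs i) md md0).
  rewrite -(ge0_integral_distribution X md md0).
  by apply: eq_measure_integral => A mA _; exact: Xs_law.
have sum_cst q : (\sum_(i < q) distortion P X c = q%:R%:E * distortion P X c)%E.
  elim: q => [|q IH]; first by rewrite big_ord0 mul0e.
  by rewrite big_ord_recr /= IH -natr1 EFinD ge0_muleDl ?mul1e ?lee_fin.
rewrite sum_cst muleA -EFinM mulVf ?mul1e //.
by rewrite pnatr_eq0 -lt0n.
Qed.

(** Uses sqrt n <= n <= 2^n. *)
Lemma grid_error_le : 4 * grid_error <= 38 * (rad / Num.sqrt n%:R).
Proof.
have s0 : 0 < Num.sqrt n%:R :> R by rewrite sqrtr_gt0 ltr0n.
have : Num.sqrt n%:R <= 2 ^+ n :> R.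
  apply: (@le_trans _ _ n%:R); last by rewrite -natrX ler_nat ltnW // ltn_expl.
  rewrite -[X in _ <= X](sqr_sqrtr (ler0n R n)) expr2 ler_peMl ?(ltW s0) //.
  by rewrite -[X in X <= _]sqrtr1 ler_sqrt ?ler1n.
move=> sn; have : grid_error <= rad / Num.sqrt n%:R.
  by rewrite ler_pM2l // lef_pV2 ?posrE ?exprn_gt0.
have := divr_ge0 (ltW rad_gt0) (ltW s0); lra.
Qed.

(** The penalty exceeds what concentration asks for by 38 rad sqrt(k d / n), which
absorbs the rounding error. *)
Lemma penalized_excess_le k (x pen : R) : (0 < k)%N -> 0 <= x ->
  rad * (48 * Num.sqrt ((k%:R * d%:R) / n%:R)
         + 2 * Num.sqrt (x / (2 * n%:R))) <= pen ->
  iid_mean grid_law n (fun s =>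
    Num.max 0 (max_dev k n grid_law zero_code s - (pen - 4 * grid_error))) <=
  expR (- x) * (rad * Num.sqrt (pi / (2 * n%:R))).
Proof.
move=> k0 x0 penk.
have kd := sqrtV_le_rate R k0 d_gt0 n_gt0.
apply: le_trans (max_dev_excess_le d_gt0 k0 n_gt0 mesh_gt0 radius_mesh
  grid_law_ge0 grid_law_sum1 zero_code x0 _) _.
  have := ler_wpM2l (ltW rad_gt0) kd; have := grid_error_le; move: penk; lra.
rewrite ler_wpM2l ?expR_ge0 // ler_wpM2l ?(ltW rad_gt0) //.
rewrite -sqrtrV ?ler0n // ler_sqrt; last by rewrite divr_ge0 ?pi_ge0 // mulr_ge0.
rewrite invfM mulrA ler_peMl ?invr_ge0 //.
by rewrite ler_pdivlMr // mul1r pi_ge2.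
Qed.

End Transfer.

Unset Implicit Arguments.

(** * The oracle inequality *)

Theorem theorem3p2 (R : realType) (d n : nat) (rad : R)
    (disp : measure_display) (T : measurableType disp) (P : probability T R)
    (X : {RV P >-> Rvec R d}) (Xs : 'I_n -> {RV P >-> Rvec R d})
    (Q : set (Rvec R d)) (x pen : nat -> R)
    (chat : forall k : nat, n.-tuple (Rvec R d) -> k.-tuple (Rvec R d))
    (khat : n.-tuple (Rvec R d) -> nat)
    (hd : (1 <= d)%N) (hn : (1 <= n)%N) (hrad : 0 < rad)
    (hX : {ae P, forall w, enorm (X w) <= rad})
    (hlaw : forall i, same_law (Xs i) X)
    (hindep : mutually_independent P (fun i w => Xs i w))
    (Qcountable : countable Q) (Qnonempty : Q !=set0)
    (Qball : forall q, Q q -> enorm q <= rad)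
    (hx : forall k, (1 <= k <= n)%N -> 0 <= x k)
    (hpen0 : forall k, (1 <= k <= n)%N -> 0 <= pen k)
    (hpen : forall k, (1 <= k <= n)%N ->
       rad * (48 * Num.sqrt ((k%:R * d%:R) / n%:R)
              + 2 * Num.sqrt (x k / (2 * n%:R))) <= pen k)
    (chat_meas : forall k, (1 <= k <= n)%N -> measurable_fun setT (chat k))
    (chat_min : forall k, (1 <= k <= n)%N -> forall w,
       let s := sample (fun i => Xs i) w in
       is_minimizer (codebooks Q k) (fun c => emp_distortion s c) (chat k s))
    (khat_meas : measurable_fun setT khat)
    (khat_min : forall w,
       let s := sample (fun i => Xs i) w in
       is_minimizer [set k | (1 <= k <= n)%N] (crit chat pen s) (khat s)) :
  (\int[P]_w
     (let s := sample (fun i => Xs i) w in distortion P X (chat (khat s) s))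
   <= ereal_inf
        [set ereal_inf [set distortion P X c | c in codebooks Q k] + (pen k)%:E
        | k in [set k | (1 <= k <= n)%N]]
      + ((\sum_(1 <= k < n.+1) expR (- x k)) * rad
         * Num.sqrt (pi / (2 * n%:R)))%:E)%E.
Proof.
pose s w := sample (fun i => Xs i) w.
pose rem := rad * Num.sqrt (pi / (2 * n%:R)).
pose excess k t := Num.max 0
  (max_dev k n (grid_law X hrad) (zero_code d n hrad) t - (pen k - 4 * grid_error n rad)).
have excess0 k t : 0 <= excess k t by rewrite le_max lexx.
have book_ball k c j : codebooks Q k c -> enorm (tnth c j) <= rad.
  by move=> Qc; apply: Qball; exact: Qc.
(* the infima over k and c are taken at the end, so k0 and c0 are fixed here *)
have oracle k0 c0 : (1 <= k0 <= n)%N -> codebooks Q k0 c0 ->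
  (\int[P]_w distortion P X (chat (khat (s w)) (s w)) <=
   distortion P X c0 + (pen k0 + (\sum_(1 <= k < n.+1) expR (- x k)) * rem)%:E)%E.
  move=> k0n Qc0.
  have k0_gt0 : (0 < k0)%N by case/andP: k0n.
  have [out_meas out0] := outside_ball_null hX hlaw.
  have [memp iemp] := emp_distortion_mean hn hlaw c0.
  have ex k := grid_sample_mean hd hrad hlaw hindep (excess0 k).
  (* measurable majorant of the distortion of the selected codebook, in which the
     random khat is replaced by a sum over all sizes *)
  pose g w : \bar R := ((emp_distortion (s w) c0)%:E + (pen k0)%:E +
     \sum_(1 <= k < n.+1) (excess k (grid_sample Xs hrad w))%:E)%E.
  have emp0 w : 0 <= emp_distortion (s w) c0.
    by rewrite mulr_ge0 ?invr_ge0 // sumr_ge0 // => i _; exact: min_dist_ge0.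
  have mex : measurable_fun [set: T] (fun w =>
      \sum_(1 <= k < n.+1) (excess k (grid_sample Xs hrad w))%:E)%E.
    by apply: emeasurable_sum => k; case: (ex k).
  have mg : measurable_fun [set: T] g.
    by apply: emeasurable_funD => //; apply: emeasurable_funD.
  have sum0 w : (0 <= \sum_(1 <= k < n.+1) (excess k (grid_sample Xs hrad w))%:E)%E.
    by apply: sume_ge0 => k _; rewrite lee_fin.
  have ep0 w : (0 <= (emp_distortion (s w) c0)%:E + (pen k0)%:E)%E.
    by rewrite adde_ge0 // lee_fin // hpen0.
  apply: (@le_trans _ _ (\int[P]_w g w)%E).
    apply: (ge0_integral_le_off_null out_meas out0) => //.
    - by move=> w; rewrite distortionE integral_ge0 // => w' _; rewrite lee_fin min_dist_ge0.
    - by move=> w; rewrite adde_ge0.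
    move=> w good; have [Kn Kmin] := khat_min w.
    rewrite -/(s w) in Kn Kmin *; set K := khat (s w) in Kn Kmin *.
    have [QK _] := chat_min K Kn w; rewrite -/(s w) in QK.
    have [_ min0] := chat_min k0 k0n w; rewrite -/(s w) in min0.
    have K0 : (0 < K)%N by case/andP: Kn.
    apply: le_trans (distortion_le_emp hd hn hrad hX K0 (fun j => book_ball _ _ j QK) good) _.
    rewrite /g sumEFin -!EFinD lee_fin.
    have := Kmin k0 k0n; rewrite /crit => cK.
    have h0 := min0 c0 Qc0.
    apply: (@le_trans _ _ (emp_distortion (s w) c0 + pen k0 + excess K (grid_sample Xs hrad w))).
      have : max_dev K n (grid_law X hrad) (zero_code d n hrad) (grid_sample Xs hrad w)
        - (pen K - 4 * grid_error n rad) <= excess K (grid_sample Xs hrad w).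
        by rewrite le_max lexx orbT.
      by move: cK h0; rewrite -/(s w) -/K; lra.
    rewrite lerD2l (bigD1_seq K) ?iota_uniq ?mem_index_iota //=.
    by rewrite lerDl sumr_ge0.
  rewrite ge0_integralD //; last by apply: emeasurable_funD.
  rewrite ge0_integralD //; last first.
  - by move=> w _; rewrite lee_fin hpen0.
  - by move=> w _; rewrite lee_fin.
  rewrite iemp integral_cst // [X in (_ * X)%E](probability_setT P) mule1.
  rewrite ge0_integral_sum //; first last.
  - by move=> k w _; rewrite lee_fin.
  - by move=> k; case: (ex k).
  rewrite EFinD addeA leeD2l // mulr_suml -sumEFin.
  rewrite big_seq [leRHS]big_seq; apply: lee_sum => k.
  rewrite mem_index_iota => kn.
  have [_ ->] := ex k; rewrite lee_fin.
  apply: (penalized_excess_le X hd hn hrad) => //; [by case/andP: kn|exact: hx|exact: hpen].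
rewrite -mulrA -/rem.
rewrite -leeBlDr //; apply: le_ereal_inf_tmp => _ [k0 k0n <-].
rewrite leeBlDr // -addeA -EFinD -leeBlDr //.
apply: le_ereal_inf_tmp => _ [c0 Qc0 <-]; rewrite leeBlDr //.
exact: oracle.
Qed.
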